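(* Let $d\ge5$ and let $a,b\ge1$ be integers with $a+b=d$. A separable family contributes total degree $d-2$ to $N^{\mathrm{s}}_{(a,b)}$ only if it is single-side; every other separable family contributes total degree at most $d-3$ to $N^{\mathrm{s}}_{(a,b)}$.
   Context: $G_{m,n}$ ($m,n\ge2$) is the $m\times n$ grid graph with cells $(i,j)$, $1\le i\le m$, $1\le j\le n$, two cells adjacent when they differ by one in a single coordinate. A height function on $G_{m,n}$ is a map $h\colon G_{m,n}\to\mathbb{Z}$ with $|h(u)-h(v)|=1$ on every edge $uv$ and $h(1,1)=0$. A cell is a strict local minimum (maximum) of $h$ if every neighbour has value larger (smaller) by one. A height function is encoded by the admissible configuration whose apexes are its strict local minima, with offsets the values of $h$ there; $h$ is then the lower envelope of that configuration, and ''configuration'' and ''height function'' may be identified here. A height function (configuration) is separable if $h(i,j)=\phi(i)+\psi(j)$ for some functions $\phi,\psi$. $N^{\mathrm{s}}_{(a,b)}(m,n)$ is the number of separable height functions on $G_{m,n}$ with exactly $a$ strict local minima and exactly $b$ strict local maxima. A separable family, for integers $\rho,\gamma,\rho',\gamma'\ge1$ with $a=\rho\gamma$ and $b=\rho'\gamma'$, consists of all height functions counted by $N^{\mathrm{s}}_{(a,b)}$ whose minima occupy exactly $\rho$ rows and $\gamma$ columns and whose maxima occupy exactly $\rho'$ rows and $\gamma'$ columns. Its count, as a function of $(m,n)$ with $m,n\ge2$, is a polynomial in $(m,n)$; the total degree the family contributes is the total degree of this polynomial (a family with identically zero count contributes nothing). The family is single-side if, for each of its members, all the strict local minima lie on a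 single side of the grid, the sides being the top row $i=1$, bottom row $i=m$, left column $j=1$ and right column $j=n$. *)

(* Defs.v *)
From mathcomp Require Import all_boot all_order all_algebra.
From mathcomp Require Import finmap mpoly.

Set Implicit Arguments.
Unset Strict Implicit.
Unset Printing Implicit Defensive.

Import Order.TTheory GRing.Theory Num.Theory.
Local Open Scope ring_scope.

(* Rows and columns are numbered from 0, so the cell (1, 1) of the paper is
   (0, 0) here; a map from the grid to the integers is an integer matrix. *)
Section Grid.
Variables m n : nat.

Definition cell : finType := ('I_m * 'I_n)%type.

Definition differ_by_one (i j : nat) : bool := (i.+1 == j) || (j.+1 == i).

Definition adj (u v : cell) : bool :=
  (u.1 == v.1) && differ_by_one u.2 v.2 ||
  (u.2 == v.2) && differ_by_one u.1 v.1.

Definition val_at (h : 'M[int]_(m, n)) (u : cell) : int := h u.1 u.2.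

Definition height_function (h : 'M[int]_(m, n)) : Prop :=
  (forall u v : cell, adj u v -> `|val_at h u - val_at h v| = 1) /\
  (forall u : cell, u.1 = 0%N :> nat -> u.2 = 0%N :> nat -> val_at h u = 0).

Definition separable (h : 'M[int]_(m, n)) : Prop :=
  exists (phi : 'I_m -> int) (psi : 'I_n -> int),
    forall i j, h i j = phi i + psi j.

Definition minima (h : 'M[int]_(m, n)) : {set cell} :=
  [set u | [forall v, adj u v ==> (val_at h v == val_at h u + 1)]].

Definition maxima (h : 'M[int]_(m, n)) : {set cell} :=
  [set u | [forall v, adj u v ==> (val_at h v == val_at h u - 1)]].

Definition rows_of (A : {set cell}) : {set 'I_m} := [set u.1 | u in A].
Definition cols_of (A : {set cell}) : {set 'I_n} := [set u.2 | u in A].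

(* The height functions counted by N^s_(a,b)(m, n). *)
Definition separable_counted (a b : nat) (h : 'M[int]_(m, n)) : Prop :=
  [/\ height_function h, separable h, #|minima h| = a & #|maxima h| = b].

Definition in_family (a b rho gamma rho' gamma' : nat)
    (h : 'M[int]_(m, n)) : Prop :=
  [/\ separable_counted a b h,
      #|rows_of (minima h)| = rho, #|cols_of (minima h)| = gamma,
      #|rows_of (maxima h)| = rho' & #|cols_of (maxima h)| = gamma'].

Definition on_single_side (A : {set cell}) : Prop :=
  [\/ forall u, u \in A -> u.1 = 0%N :> nat,
      forall u, u \in A -> u.1 = m.-1 :> nat,
      forall u, u \in A -> u.2 = 0%N :> nat |
      forall u, u \in A -> u.2 = n.-1 :> nat].

End Grid.

Definition has_cardinal (T : choiceType) (P : T -> Prop) (k : nat) : Prop :=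
  exists2 S : {fset T}, forall x, x \in S <-> P x & #|` S| = k.

Definition eval2 (p : {mpoly rat[2]}) (m n : nat) : rat :=
  p.@[tnth [tuple m%:R; n%:R]].

Definition family_count_poly (a b rho gamma rho' gamma' : nat)
    (p : {mpoly rat[2]}) : Prop :=
  forall m n : nat, (2 <= m)%N -> (2 <= n)%N ->
    exists2 k : nat,
      has_cardinal (@in_family m n a b rho gamma rho' gamma') k &
      eval2 p m n = k%:R.

(* [msize p] is the total degree plus one, and 0 for the zero polynomial, so a
   family whose count is identically zero contributes no total degree. *)
Definition contributes_degree (a b rho gamma rho' gamma' k : nat) : Prop :=
  exists2 p : {mpoly rat[2]},
    family_count_poly a b rho gamma rho' gamma' p & msize p = k.+1.

Definition single_side (a b rho gamma rho' gamma' : nat) : Prop :=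
  forall (m n : nat) (h : 'M[int]_(m, n)), (2 <= m)%N -> (2 <= n)%N ->
    in_family a b rho gamma rho' gamma' h -> on_single_side (minima h).

(* Main.v *)
Require Import Defs.
From mathcomp Require Import all_boot all_order all_algebra.
From mathcomp Require Import finmap mpoly zify.

Set Implicit Arguments.
Unset Strict Implicit.
Unset Printing Implicit Defensive.

Import Order.TTheory GRing.Theory Num.Theory.

(** A separable height function with value 0 at the corner is the sum
    [walk s i + walk t j] of two walks with steps 1 and -1, and the pair of step
    sequences [(s, t)] is determined by it ([separable_heightP],
    [height_of_inj]).  A neighbour of a cell moves only one of the two walks, so
    the cell is a strict local minimum exactly when both of its coordinates are
    strict local minima (dips) of their walks ([minima_height_of]), and the
    maxima come from the peaks in the same way.  The minima thus form the
    product of the dips of [s] by the dips of [t], and belonging to a family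
    means that [s] has [rho] dips and [rho'] peaks while [t] has [gamma] dips
    and [gamma'] peaks ([in_familyP]).

    Dips and peaks of a walk alternate, the two ends included.  A walk on
    [L + 2] points with [x] dips and [y] peaks therefore exists only if [x] and
    [y] differ by at most one, and it is given by its first direction and by its
    [x + y - 2] turning points among the [L] interior points ([card_walks]).
    Hence the family count is a constant times
    [C(m - 2, rho + rho' - 2) * C(n - 2, gamma + gamma' - 2)], a polynomial of
    total degree [rho + rho' + gamma + gamma' - 4] unless the constant vanishes.
    A polynomial in two variables is determined by its values at integers at
    least 2 ([eval2_eq0]), so this is the only degree that the family can
    contribute.

    Finally [x + y <= x * y + 1] for positive [x] and [y], with equality iff one
    of them is 1.  So the degree is at most [rho * gamma + rho' * gamma' - 2],
    that is [d - 2], and equality needs a 1 in each of the pairs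
    [(rho, gamma)] and [(rho', gamma')].  If these are [rho] and [gamma'], then
    [rho'] and [gamma] are at most 2 because dips and peaks alternate, which
    forces [d <= 4]; the pair [gamma] and [rho'] is excluded likewise.  In the
    remaining cases one of the two walks has a single dip and a single peak, so
    it is monotone, its dip is an end, and all minima lie on one side
    ([single_side_one_one]). *)

(** * Walks with given numbers of dips and peaks *)

(** A walk is encoded by its steps, [true] being up.  The argument [p] is the
    step before the first point; a step up is added after the last point, so
    that with [p = false] an end of the walk is a dip when its only neighbour is
    higher. *)
Fixpoint dips (p : bool) (s : seq bool) : nat :=
  if s is b :: s' then (~~ p && b) + dips b s' else ~~ p.

Definition peaks (p : bool) (s : seq bool) : nat := dips (~~ p) (map negb s).

(** The same convention at the ends: [false] is put in front of [s], and the
    default value [true] of [nth] is the step beyond its end. *)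
Definition is_dip (s : seq bool) (i : nat) : bool :=
  ~~ nth false (false :: s) i && nth true s i.

Lemma dips_sum p s :
  dips p s = \sum_(i < (size s).+1) (~~ nth false (p :: s) i && nth true s i).
Proof.
elim: s p => [|b s IHs] p /=; first by rewrite big_ord1 andbT.
by rewrite big_ord_recl IHs.
Qed.

Lemma card_is_dip L s : size s = L ->
  #|[set i : 'I_L.+1 | is_dip s i]| = dips false s.
Proof.
move=> <-; rewrite dips_sum -sum1_card big_mkcond /=.
by apply: eq_bigr => i _; rewrite inE /is_dip; case: (_ && _).
Qed.

Lemma dips_false_gt0 s : 0 < dips false s.
Proof. by elim: s => // -[] s IHs. Qed.

(** After a step down the walk has to reach a dip, so a walk that is going up
    and has no further dip never goes down again. *)
Lemma dips_true_eq0 s : dips true s = 0 -> all id s.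
Proof.
elim: s => //= b s IHs; case: b => [|] /=; first by rewrite add0n.
by have := dips_false_gt0 s; lia.
Qed.

Lemma one_dip_one_peak s : dips false s = 1 -> peaks true s = 1 ->
  all id s \/ all negb s.
Proof.
rewrite /peaks; case: s => [|b s]; first by left.
case: b => /= [[/dips_true_eq0 h] _|_ [/dips_true_eq0 h]]; [by left|right].
by rewrite all_map in h.
Qed.

Lemma card_tuple_cons L (P : pred (seq bool)) :
  #|[set t : L.+1.-tuple bool | P t]| =
  #|[set t : L.-tuple bool | P (true :: t)]| +
  #|[set t : L.-tuple bool | P (false :: t)]|.
Proof.
have card_cons b : #|[set t : L.-tuple bool | P (b :: t)]| =
    #|[set t : L.+1.-tuple bool | (thead t == b) && P t]|.
  have consI : injective (fun t : L.-tuple bool => [tuple of b :: t]).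
    by move=> t u /(congr1 val) [] /val_inj.
  rewrite -(card_imset _ consI); apply: eq_card => t; rewrite inE.
  apply/imsetP/andP => [[u]|[/eqP tb Pt]].
    by rewrite inE => Pu ->; rewrite theadE.
  exists [tuple of behead t]; rewrite ?inE; last first.
    by rewrite -tb; apply: tuple_eta.
  by move: Pt; rewrite {1}(tuple_eta t) tb.
rewrite !card_cons -cardsUI [X in _ = _ + X]eq_card0 ?addn0.
  apply: eq_card => t; rewrite !inE.
  by case: (thead t); rewrite ?orbF.
by move=> t; rewrite !inE; case: (thead t); rewrite ?andbF.
Qed.

(** Once the direction [p] in which the walk enters its first point is fixed,
    its extrema alternate, starting with a peak if [p] is up and with a dip
    otherwise.  This decides which pairs [(x, y)] occur; the last of the
    [x + y] extrema is the final point and the other ones are free among the [L]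
    points before it.  Splitting on the first step turns this into Pascal's
    rule. *)
Lemma card_dips_peaks L p x y :
  #|[set t : L.-tuple bool | (dips p t == x) && (peaks p t == y)]| =
  ((0 < x + y) && (if p then (y == x) || (y == x.+1)
                   else (x == y) || (x == y.+1))) * 'C(L, (x + y).-1).
Proof.
elim: L p x y => [|L IHL] p x y.
  rewrite (_ : [set t | _] = if (x == ~~ p) && (y == p) then setT else set0).
    case: ifP; rewrite ?cards0 ?cardsT ?card_tuple; case: p => /=;
    rewrite bin0n; lia.
  apply/setP => t; rewrite inE tuple0 /peaks /= negbK [x == _]eq_sym.
  by rewrite [y == _]eq_sym; case: ifP; rewrite inE.
rewrite (card_tuple_cons L (fun t => (dips p t == x) && (peaks p t == y))).
case: p; rewrite /peaks /=.
  rewrite -/(peaks true _); rewrite IHL /=.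
  case: y => [|y].
    rewrite [X in _ + X]eq_card0 ?addn0; first by case: x.
    by move=> t; rewrite !inE andbC.
  rewrite (IHL false x y) /= ?addnS /=; case e: (x + y) => [|c].
    by rewrite !bin0; lia.
  by rewrite binS /=; lia.
rewrite (IHL false x y) /=.
case: x => [|x].
  rewrite [X in X + _]eq_card0 //=; first by case: y.
  by move=> t; rewrite !inE.
rewrite (IHL true x y) /= ?addSn /=; case e: (x + y) => [|c].
  by rewrite !bin0; lia.
by rewrite binS /=; lia.
Qed.

(** Number of first directions compatible with [x] dips and [y] peaks: a walk
    going up starts with a dip, hence has as many dips as peaks or one dip more,
    and symmetrically. *)
Definition start_choices x y : nat :=
  ((x == y) || (x == y.+1)) + ((x == y) || (y == x.+1)).

Lemma card_walks L x y : 0 < x -> 0 < y ->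
  #|[set t : L.+1.-tuple bool | (dips false t == x) && (peaks true t == y)]| =
  start_choices x y * 'C(L, x + y - 2).
Proof.
case: x y => [|x] [|y] // _ _.
rewrite (card_tuple_cons L
  (fun t => (dips false t == x.+1) && (peaks true t == y.+1))) /peaks /=.
rewrite (card_dips_peaks L true x y.+1) (card_dips_peaks L false x.+1 y) /=.
by rewrite /start_choices !addnS !addSn /= subn2 /=; lia.
Qed.

(** * Separable height functions as pairs of walks *)

Local Open Scope ring_scope.

Definition walk (s : seq bool) (i : nat) : int :=
  \sum_(k < i) (if nth false s k then 1 else -1).

Lemma walk0 s : walk s 0 = 0. Proof. exact: big_ord0. Qed.

Lemma walkS s i : walk s i.+1 = walk s i + (if nth false s i then 1 else -1).
Proof. exact: big_ord_recr. Qed.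

Lemma walk_negb s i : (i <= size s)%N -> walk (map negb s) i = - walk s i.
Proof.
elim: i => [|i IHi] le_i; first by rewrite !walk0 oppr0.
rewrite !walkS (IHi (ltnW le_i)) (nth_map false) //; case: nth => /=; lia.
Qed.

Lemma is_dip_walk L s (i : 'I_L.+1) : size s = L ->
  is_dip s i = [forall j : 'I_L.+1, differ_by_one i j ==>
                  (walk s j == walk s i + 1)].
Proof.
move=> sz_s; rewrite /is_dip; apply/andP/forallP => [[hl hr] j|hj].
  apply/implyP => /orP[]/eqP ij.
    rewrite -ij walkS (@set_nth_default _ s true) ?hr //.
    by rewrite sz_s -ltnS ij.
  by move: hl; rewrite -ij /= walkS => /negbTE ->; apply/eqP; lia.
split.
  case: i hj => -[//|i] /= lt_i /(_ (Ordinal (ltnW lt_i))) /implyP.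
  by rewrite /differ_by_one eqxx orbT /= walkS => /(_ isT); case: nth; lia.
case: (ltnP i L) => [lt_iL|ge_iL]; last by rewrite nth_default ?sz_s.
have:= hj (inord i.+1); rewrite inordK // /differ_by_one eqxx /= walkS.
by rewrite (@set_nth_default _ s false true) ?sz_s //; case: nth; lia.
Qed.

Definition height_of L K (s t : seq bool) : 'M[int]_(L.+1, K.+1) :=
  \matrix_(i, j) (walk s i + walk t j).

(** A neighbour of [(i, j)] changes one coordinate only, and the increment of
    the height is then the increment of the corresponding walk. *)
Lemma minima_height_of L K s t : size s = L -> size t = K ->
  minima (height_of L K s t) =
    setX [set i | is_dip s (i : 'I_L.+1)] [set j | is_dip t (j : 'I_K.+1)].
Proof.
move=> sz_s sz_t; apply/setP => -[i j]; rewrite !inE /=.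
rewrite (is_dip_walk _ sz_s) (is_dip_walk _ sz_t).
apply/forallP/andP => [h|[/forallP hi /forallP hj] [k l]].
  split; apply/forallP => k; apply/implyP => d.
    have:= h (k, j); rewrite /adj /val_at /= !mxE d eqxx orbT /=; lia.
  by have:= h (i, k); rewrite /adj /val_at /= !mxE d eqxx /=; lia.
have:= hi k; have:= hj l; rewrite /adj /val_at /= !mxE => /implyP hl /implyP hk.
by apply/implyP => /orP[] /andP[/eqP <-]; [move/hl|move/hk] => /eqP ->; lia.
Qed.

Lemma maximaE m n (h : 'M[int]_(m, n)) : maxima h = minima (- h).
Proof.
apply/setP => u; rewrite !inE; apply: eq_forallb => v; congr (_ ==> _).
by rewrite /val_at !mxE -[RHS]eqr_opp opprD !opprK.
Qed.

Lemma height_of_negb L K s t : size s = L -> size t = K ->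
  - height_of L K s t = height_of L K (map negb s) (map negb t).
Proof.
move=> sz_s sz_t; apply/matrixP => i j; rewrite !mxE.
by rewrite !walk_negb ?opprD ?sz_s ?sz_t // -ltnS.
Qed.

Lemma maxima_height_of L K s t : size s = L -> size t = K ->
  maxima (height_of L K s t) =
    setX [set i | is_dip (map negb s) (i : 'I_L.+1)]
         [set j | is_dip (map negb t) (j : 'I_K.+1)].
Proof.
by move=> sz_s sz_t; rewrite maximaE height_of_negb ?minima_height_of ?size_map.
Qed.

Lemma height_of_inj L K (s s' : L.-tuple bool) (t t' : K.-tuple bool) :
  height_of L K s t = height_of L K s' t' -> s = s' /\ t = t'.
Proof.
have walk_inj N (u u' : N.-tuple bool) :
    (forall i : 'I_N.+1, walk u i = walk u' i) -> u = u'.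
  move=> e; apply/val_inj/(@eq_from_nth _ false); rewrite !size_tuple //.
  move=> k lt_k.
  have:= e (inord k.+1); have:= e (inord k).
  by rewrite !inordK // 1?ltnW // !walkS => ->; do 2!case: nth => //; lia.
move/matrixP => e; split; apply: walk_inj => i.
  by have:= e i ord0; rewrite !mxE !walk0 !addr0.
by have:= e ord0 i; rewrite !mxE !walk0 !add0r.
Qed.

Lemma height_function_height_of L K s t : height_function (height_of L K s t).
Proof.
split=> [u v|u u1 u2]; last by rewrite /val_at mxE u1 u2 !walk0.
have walk_step r (i j : nat) : differ_by_one i j -> `|walk r i - walk r j| = 1.
  by case/orP => /eqP <-; rewrite walkS; case: nth; lia.
rewrite /val_at !mxE => /orP[] /andP[/eqP -> /walk_step step_uv].
  by rewrite -(step_uv t); congr (`|_|); lia.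
by rewrite -(step_uv s); congr (`|_|); lia.
Qed.

Lemma separable_height_of L K s t : separable (height_of L K s t).
Proof.
by exists (fun i => walk s i), (fun j => walk t j) => i j; rewrite mxE.
Qed.

Lemma walk_of_steps L (f : 'I_L.+1 -> int) : f ord0 = 0 ->
  (forall i j : 'I_L.+1, differ_by_one i j -> `|f i - f j| = 1) ->
  exists s : L.-tuple bool, forall i, f i = walk s i.
Proof.
move=> f0 f1; pose g k := f (inord k.+1) == f (inord k) + 1.
(* Only indices at most [L] reach [inord], so its default value never occurs. *)
exists [tuple of mkseq g L] => i; rewrite -[i in LHS]inord_val.
elim: {i}(i : nat) (ltn_ord i) => [|k IHk] lt_k.
  by rewrite walk0 -f0; congr f; apply: val_inj; rewrite /= inordK.
rewrite walkS -IHk ?nth_mkseq // 1?ltnW // /g.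
have:= f1 (inord k.+1) (inord k); rewrite !inordK // 1?ltnW //.
rewrite /differ_by_one eqxx orbT => /(_ isT).
by case: eqP => // ? ?; lia.
Qed.

(** The walks are the first column and the first row of [h]: as [h] vanishes at
    the corner, separability gives [h i j = h i 0 + h 0 j]. *)
Lemma separable_heightP L K (h : 'M[int]_(L.+1, K.+1)) :
  height_function h -> separable h ->
  exists (s : L.-tuple bool) (t : K.-tuple bool), h = height_of L K s t.
Proof.
move=> [h1 h0] [phi [psi hE]].
have h00 : h ord0 ord0 = 0 by apply: (h0 (ord0, ord0)).
have [s hs] : exists s : L.-tuple bool, forall i, h i ord0 = walk s i.
  apply: walk_of_steps => // i j dij.
  by apply: (h1 (i, ord0) (j, ord0)); rewrite /adj /= dij orbT.
have [t ht] : exists t : K.-tuple bool, forall j, h ord0 j = walk t j.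
  apply: walk_of_steps => // i j dij.
  by apply: (h1 (ord0, i) (ord0, j)); rewrite /adj /= dij.
exists s, t; apply/matrixP => i j; rewrite !mxE -hs -ht.
by move: h00; rewrite !hE; lia.
Qed.

Lemma rows_of_setX m n (A : {set 'I_m}) (B : {set 'I_n}) :
  (0 < #|B|)%N -> rows_of (setX A B) = A.
Proof.
case/card_gt0P => j Bj; apply/setP => i; apply/imsetP/idP => [[u]|Ai].
  by rewrite inE => /andP[? _] ->.
by exists (i, j); rewrite ?inE //= Ai.
Qed.

Lemma cols_of_setX m n (A : {set 'I_m}) (B : {set 'I_n}) :
  (0 < #|A|)%N -> cols_of (setX A B) = B.
Proof.
case/card_gt0P => i Ai; apply/setP => j; apply/imsetP/idP => [[u]|Bj].
  by rewrite inE => /andP[_ ?] ->.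
by exists (i, j); rewrite ?inE //= Ai.
Qed.

(** Every walk has a dip and a peak, so the projections of the product of two
    sets of dips are these sets, and the numbers of rows and columns of the
    extrema recover the statistics of both walks. *)
Lemma in_familyP L K rho gamma rho' gamma' (h : 'M[int]_(L.+1, K.+1)) :
  in_family (rho * gamma) (rho' * gamma') rho gamma rho' gamma' h <->
  exists (s : L.-tuple bool) (t : K.-tuple bool),
    [/\ h = height_of L K s t, dips false s = rho /\ peaks true s = rho'
      & dips false t = gamma /\ peaks true t = gamma'].
Proof.
have cards s t (h' := height_of L K s t) : size s = L -> size t = K ->
    [/\ #|minima h'| = (dips false s * dips false t)%N,
        #|maxima h'| = (peaks true s * peaks true t)%N,
        #|rows_of (minima h')| = dips false s
          /\ #|cols_of (minima h')| = dips false t,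
        #|rows_of (maxima h')| = peaks true s
      & #|cols_of (maxima h')| = peaks true t].
  move=> sz_s sz_t; rewrite /h' minima_height_of // maxima_height_of //.
  rewrite !rows_of_setX ?cols_of_setX ?cardsX;
    by rewrite ?card_is_dip ?size_map ?dips_false_gt0.
split=> [[[hf sep _ _] r c r' c']|[s [t [-> [<- <-] [<- <-]]]]].
  have [s [t hE]] := separable_heightP hf sep; exists s, t.
  have:= cards s t (size_tuple s) (size_tuple t); rewrite -hE r c r' c'.
  by case=> _ _ [-> ->] -> ->.
have:= cards s t (size_tuple s) (size_tuple t) => -[c1 c2 [c3 c4] c5 c6].
split=> //; split=> //; [exact: height_function_height_of|].
exact: separable_height_of.
Qed.

(** * Polynomials with prescribed values *)

(** The binomial coefficient [C('X_i - 2, r)] as a polynomial. *)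
Definition binomial_mpoly (i : 'I_2) (r : nat) : {mpoly rat[2]} :=
  (r`!%:R)^-1 *: \prod_(k < r) ('X_i - (k.+2)%:R%:MP).

Lemma meval_binomial_mpoly (v : 'I_2 -> rat) i r L : v i = L.+2%:R ->
  (binomial_mpoly i r).@[v] = ('C(L, r))%:R.
Proof.
move=> vi; rewrite mevalZ rmorph_prod /=.
have -> : \prod_(k < r) ('X_i - (k.+2)%:R%:MP).@[v] = (L ^_ r)%:R.
  elim: r => [|r IHr]; first by rewrite big_ord0.
  (* Truncation in [L - r] is harmless: beyond [L] a factor is already zero. *)
  rewrite big_ord_recr /= IHr ffactnSr mevalB mevalXU mevalC vi.
  case: (leqP r L) => [le_rL|lt_Lr]; last by rewrite ffact_small // !mul0r.
  rewrite natrM natrB // -(addn2 L) -(addn2 r) !natrD.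
  by rewrite opprD addrACA subrr addr0.
by rewrite -bin_ffact natrM mulrC mulfK // pnatr_eq0 -lt0n fact_gt0.
Qed.

Lemma msize_binomial_mpoly i r : msize (binomial_mpoly i r) = r.+1.
Proof.
rewrite msizeZ ?invr_eq0 ?pnatr_eq0 -?lt0n ?fact_gt0 //.
have linE c : msize ('X_i - c%:MP : {mpoly rat[2]}) = 2.
  apply/eqP; rewrite eqn_leq (leq_trans (msizeD_le _ _)) /=; last first.
    by rewrite msizeN msizeX msizeC mdeg1 geq_max leqnn; case: (c != 0).
  rewrite -[X in (X < _)%N](mdeg1 i); apply: msize_mdeg_lt.
  by rewrite mcoeff_msupp mcoeffB mcoeffC mcoeffX eqxx mnm1_eq0 mulr0 subr0
             oner_eq0.
elim: r => [|r IHr]; first by rewrite big_ord0 msize1.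
rewrite big_ord_recr /= msizeM -?msize_poly_eq0 ?IHr ?linE //.
by rewrite addn2.
Qed.

Lemma poly_eq0_inj_roots (R : idomainType) (p : {poly R}) (f : nat -> R) :
  injective f -> (forall k, p.[f k] = 0) -> p = 0.
Proof.
move=> f_inj pf0; apply: (@roots_geq_poly_eq0 _ p (mkseq f (size p))).
- by apply/allP => _ /mapP[k _ ->]; apply/rootP/pf0.
- by rewrite mkseq_uniq.
- by rewrite size_mkseq.
Qed.

(** Viewing [q] as a polynomial in the first variable with coefficients that are
    polynomials in the second, it has infinitely many roots in each variable. *)
Lemma eval2_eq0 (q : {mpoly rat[2]}) :
  (forall m n, (2 <= m)%N -> (2 <= n)%N -> eval2 q m n = 0) -> q = 0.
Proof.
move=> q0; pose i0 : 'I_2 := ord0; pose i1 : 'I_2 := ord_max.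
pose P : {poly {poly rat}} :=
  \sum_(u <- msupp q) (q@_u *: 'X^(u i1)) *: 'X^(u i0).
have natI : injective (fun k => k.+2%:R : rat).
  by move=> k l /eqP; rewrite eqr_nat => /eqP[].
have P0 : P = 0.
  apply: (@poly_eq0_inj_roots _ _ (fun k => (k.+2%:R)%:P)) => [k l|k].
    by move=> /polyC_inj /natI.
  apply: (poly_eq0_inj_roots natI) => l.
  rewrite -[RHS](q0 k.+2 l.+2) // /eval2 mevalE !horner_sum.
  apply: eq_bigr => u _; rewrite big_ord_recl big_ord1 !hornerE.
  rewrite (_ : lift ord0 ord0 = i1); last exact: val_inj.
  exact: mulrAC.
apply/mpolyP => u; rewrite mcoeff0.
case: (boolP (u \in msupp q)) => [qu|/memN_msupp_eq0 //].
have <- : (P`_(u i0))`_(u i1) = q@_u; last by rewrite P0 !coef0.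
rewrite /P !coef_sum (bigD1_seq u) ?msupp_uniq //=.
rewrite big1_seq => [|w /andP[w_u _]].
  by rewrite coefZ coefXn eqxx mulr1 coefZ coefXn eqxx mulr1 addr0.
rewrite coefZ coefXn; case: eqP => e0; last by rewrite mulr0 coef0.
rewrite mulr1 coefZ coefXn; case: eqP => e1; last by rewrite mulr0.
case/eqP: w_u; apply/mnmP => k.
by case: (unliftP i0 k) => [j|] -> //; rewrite ord1;
   rewrite (_ : lift _ _ = i1) //; apply: val_inj.
Qed.

(** * Counting a family and locating its minima *)

Lemma has_cardinal_family L K rho gamma rho' gamma' :
  (0 < rho)%N -> (0 < gamma)%N -> (0 < rho')%N -> (0 < gamma')%N ->
  has_cardinal (@in_family L.+2 K.+2 (rho * gamma) (rho' * gamma')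
                  rho gamma rho' gamma')
    (start_choices rho rho' * 'C(L, rho + rho' - 2) *
     (start_choices gamma gamma' * 'C(K, gamma + gamma' - 2))).
Proof.
move=> r0 c0 r0' c0'; rewrite -!card_walks // -cardsX.
set A := setX _ _.
pose f (x : L.+1.-tuple bool * K.+1.-tuple bool) :=
  height_of L.+1 K.+1 x.1 x.2.
exists [fset f x | x in A]%fset => [h|].
  split=> [/imfsetP[[s t]]|/in_familyP[s [t [-> [ds ps] [dt pt]]]]].
    rewrite !inE /= => /andP[/andP[/eqP <- /eqP <-] /andP[/eqP <- /eqP <-]] ->.
    by apply/in_familyP; exists s, t.
  by apply/imfsetP; exists (s, t); rewrite // !inE /= ds ps dt pt !eqxx.
rewrite card_in_imfset /= -?cardE // => -[s t] [s' t'] _ _ /=.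
by move=> /height_of_inj[/= -> ->].
Qed.

Lemma has_cardinal_unique (T : choiceType) (P : T -> Prop) k l :
  has_cardinal P k -> has_cardinal P l -> k = l.
Proof.
move=> [A AP <-] [B BP <-]; congr #|` _|; apply/fsetP => x.
by apply/idP/idP => /[dup] ?; [move/AP/BP|move/BP/AP].
Qed.

(** A walk with a single dip and a single peak is monotone, so its dip is one of
    its two ends. *)
Lemma single_side_one_one a b rho gamma rho' gamma' :
  a = (rho * gamma)%N -> b = (rho' * gamma')%N ->
  (rho = 1 /\ rho' = 1)%N \/ (gamma = 1 /\ gamma' = 1)%N ->
  single_side a b rho gamma rho' gamma'.
Proof.
have dip_end L (s : L.-tuple bool) : dips false s = 1%N -> peaks true s = 1%N ->
    (forall i : nat, (i <= L)%N -> is_dip s i -> i = 0%N)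
    \/ (forall i : nat, (i <= L)%N -> is_dip s i -> i = L).
  move=> d1 p1.
  case: (one_dip_one_peak d1 p1) => [/(all_nthP false)|/(all_nthP true)] h;
    [left|right].
    by case=> // i lt_i; rewrite /is_dip /= h ?size_tuple.
  move=> i le_i /andP[_]; rewrite leq_eqVlt in le_i.
  by case/predU1P: le_i => // lt_i; rewrite (negbTE (h i _)) ?size_tuple.
move=> -> -> one [|m] [|n] h // _ _ /in_familyP[s [t [-> [ds ps] [dt pt]]]].
rewrite minima_height_of ?size_tuple //.
case: one => -[e e']; rewrite e e' in ds ps dt pt.
  case: (dip_end _ _ ds ps) => end_s; [apply: Or41|apply: Or42] => -[i j];
  rewrite !inE /= => /andP[hi _]; by apply: end_s => //; rewrite -ltnS.
case: (dip_end _ _ dt pt) => end_s; [apply: Or43|apply: Or44] => -[i j];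
rewrite !inE /= => /andP[_ hi]; by apply: end_s => //; rewrite -ltnS.
Qed.

(** * Degrees contributed by a family *)

Definition family_poly rho gamma rho' gamma' : {mpoly rat[2]} :=
  (start_choices rho rho' * start_choices gamma gamma')%:R *:
  (binomial_mpoly ord0 (rho + rho' - 2) *
   binomial_mpoly ord_max (gamma + gamma' - 2)).

Lemma family_polyP a b rho gamma rho' gamma' :
  (0 < rho)%N -> (0 < gamma)%N -> (0 < rho')%N -> (0 < gamma')%N ->
  a = (rho * gamma)%N -> b = (rho' * gamma')%N ->
  family_count_poly a b rho gamma rho' gamma'
    (family_poly rho gamma rho' gamma').
Proof.
move=> r0 c0 r0' c0' -> -> [|[|m]] // [|[|n]] // _ _.
eexists; first exact: has_cardinal_family.
rewrite /eval2 mevalZ mevalM (@meval_binomial_mpoly _ _ _ m) //.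
by rewrite (@meval_binomial_mpoly _ _ _ n) // -!natrM mulnACA.
Qed.

Lemma family_count_poly_unique a b rho gamma rho' gamma' p q :
  family_count_poly a b rho gamma rho' gamma' p ->
  family_count_poly a b rho gamma rho' gamma' q -> p = q.
Proof.
move=> cp cq; apply/eqP; rewrite -subr_eq0; apply/eqP/eval2_eq0 => m n m2 n2.
have [k ck ek] := cp m n m2 n2; have [l cl el] := cq m n m2 n2.
move: ek el; rewrite /eval2 mevalB => -> ->.
by rewrite (has_cardinal_unique ck cl) subrr.
Qed.

Lemma msize_family_poly rho gamma rho' gamma' k :
  msize (family_poly rho gamma rho' gamma') = k.+1 ->
  k = (rho + rho' - 2 + (gamma + gamma' - 2))%N /\
  (0 < start_choices rho rho' * start_choices gamma gamma')%N.
Proof.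
rewrite /family_poly; case: posnP => [->|c0]; first by rewrite scale0r msize0.
have mb0 i r : binomial_mpoly i r != 0.
  by rewrite -msize_poly_eq0 msize_binomial_mpoly.
rewrite msizeZ ?pnatr_eq0 -?lt0n // msizeM //.
by rewrite !msize_binomial_mpoly addSn addnS /= => -[->].
Qed.

Local Close Scope ring_scope.

(** A large degree forces equality in [x + y <= x * y + 1] for both pairs, which
    puts a 1 in each of them; the mixed cases have [rho * gamma] and
    [rho' * gamma'] at most 2, since dips and peaks alternate. *)
Lemma one_one_of_degree rho gamma rho' gamma' :
  (0 < rho) -> (0 < gamma) -> (0 < rho') -> (0 < gamma') ->
  (5 <= rho * gamma + rho' * gamma') ->
  (0 < start_choices rho rho' * start_choices gamma gamma') ->
  (rho * gamma + rho' * gamma' - 2 <=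
     rho + rho' - 2 + (gamma + gamma' - 2)) ->
  (rho = 1 /\ rho' = 1) \/ (gamma = 1 /\ gamma' = 1).
Proof.
rewrite muln_gt0 => r0 c0 r0' c0' h5 /andP[s1 s2] hd.
have near x y : (0 < start_choices x y) -> (x <= y.+1 /\ y <= x.+1).
  by rewrite /start_choices; lia.
have [? ?] := near _ _ s1; have [? ?] := near _ _ s2.
have one x y : (0 < x -> 0 < y -> x + y <= (x * y).+1) by nia.
have tight x y : (0 < x -> 0 < y -> x * y < x + y -> x = 1 \/ y = 1) by nia.
have [lt_m lt_M] :
    (rho * gamma < rho + gamma /\ rho' * gamma' < rho' + gamma').
  by have := one _ _ r0 c0; have := one _ _ r0' c0'; lia.
have [e|e] := tight _ _ r0 c0 lt_m; have [e'|e'] := tight _ _ r0' c0' lt_M;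
  rewrite ?e ?e' in h5 *; lia.
Qed.

(** The third clause follows from the second: the degree is at most [d - 2], and
    a family that reaches [d - 2] is single-side. *)
Theorem theorem10p3 (d a b : nat) (hd : 5 <= d) (ha : 1 <= a) (hb : 1 <= b)
    (hab : a + b = d)
    (rho gamma rho' gamma' : nat)
    (hrho : 1 <= rho) (hgamma : 1 <= gamma)
    (hrho' : 1 <= rho') (hgamma' : 1 <= gamma')
    (ha_eq : a = rho * gamma) (hb_eq : b = rho' * gamma') :
  [/\ exists p, family_count_poly a b rho gamma rho' gamma' p,
      contributes_degree a b rho gamma rho' gamma' (d - 2) ->
        single_side a b rho gamma rho' gamma'
    & ~ (contributes_degree a b rho gamma rho' gamma' (d - 2) /\
         single_side a b rho gamma rho' gamma') ->
        forall k, contributes_degree a b rho gamma rho' gamma' k -> k <= d - 3].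
Proof.
have cp := family_polyP hrho hgamma hrho' hgamma' ha_eq hb_eq.
have degree k : contributes_degree a b rho gamma rho' gamma' k ->
    k = rho + rho' - 2 + (gamma + gamma' - 2) /\
    0 < start_choices rho rho' * start_choices gamma gamma'.
  case=> p cp'; rewrite (family_count_poly_unique cp' cp).
  exact: msize_family_poly.
have side : contributes_degree a b rho gamma rho' gamma' (d - 2) ->
    single_side a b rho gamma rho' gamma'.
  move=> /degree[ed pos]; apply: single_side_one_one => //.
  by apply: one_one_of_degree => //; lia.
split=> [||max_fails k ck].
- by exists (family_poly rho gamma rho' gamma').
- exact: side.
have [ek pos] := degree k ck.
have neq_k : k <> d - 2.
  by move=> e; rewrite e in ck; apply: max_fails; split=> //; apply: side.
have : rho + gamma <= (rho * gamma).+1 by nia.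
have : rho' + gamma' <= (rho' * gamma').+1 by nia.
lia.
Qed.
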